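(* Let $n,p$ be positive integers. The tensor commutation matrix $[U_{n\otimes p}]$, of size $np\times np$, is obtained by the following procedure. Put $1$ at the first row and first column; then pass to the second column, going down $n$ rows, and put $1$ there; then pass to the third column, going down $n$ rows, and put $1$ there; and so on, until only $n-1$ rows remain below (at this point $p$ entries $1$ have been placed). Then pass to the next column, the $(p+1)$-th, put $1$ at the second row of this column, and repeat the process (each time passing to the next column and going down $n$ rows) until only $n-2$ rows remain below (at this point $2p$ entries $1$ have been placed). Then pass to the next column, the $(2p+1)$-th, put $1$ at the third row of this column, and repeat the process until only $n-3$ rows remain below (at this point $3p$ entries $1$ have been placed). Continue in this way until the entry at the $np$-th row and $np$-th column is $1$. All other entries are $0$.
   Context: The tensor commutation matrix $[U_{n\otimes p}]$ is the $np\times np$ matrix with entries $0$ and $1$ such that $[U_{n\otimes p}]\cdot([a]\otimes[b])=[b]\otimes[a]$ for all column matrices $[a]\in\mathcal{M}_{n\times 1}(\mathbb{K})$ and $[b]\in\mathcal{M}_{p\times 1}(\mathbb{K})$, where $\mathbb{K}=\mathbb{R}$ or $\mathbb{C}$ and $\otimes$ is the Kronecker product of matrices (the $(i,j)$ block of $[A]\otimes[B]$ is $A^i_j[B]$). *)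

(* Defs.v *)
From mathcomp Require Import all_boot all_order all_algebra.
From mathcomp Require Import reals.
From mathcomp.real_closed Require Import complex mxtens.

Set Implicit Arguments.
Unset Strict Implicit.
Unset Printing Implicit Defensive.

Import GRing.Theory Num.Theory.
Local Open Scope ring_scope.

(* [A *t B] is the Kronecker product of mxtens: its block of index (i, j) is
   [A i j *: B].  The cast only identifies the heights p * n and n * p. *)
Definition is_tensor_commutation (K : pzRingType) (n p : nat)
    (U : 'M[K]_(n * p)) : Prop :=
  (forall i j, U i j = 0 \/ U i j = 1) /\
  (forall (a : 'cV[K]_n) (b : 'cV[K]_p),
     U *m (a *t b) = castmx (mulnC p n, erefl) (b *t a)).

Local Open Scope nat_scope.

(* The last entry 1 put by the procedure.  Rows and columns are numbered from
   1, and [pass] is k while the entries put are those of the run of p columns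
   that starts at the k-th row. *)
Record cursor := Cursor { pass : nat; row : nat; col : nat }.

Definition start : cursor := Cursor 1 1 1.

Definition rows_below (n p : nat) (c : cursor) : nat := n * p - row c.

Definition next (n p : nat) (c : cursor) : cursor :=
  if rows_below n p c == n - pass c
  then Cursor (pass c).+1 (pass c).+1 (col c).+1
  else Cursor (pass c) (row c + n) (col c).+1.

(* The position of the entry put after t moves: at that point t + 1 entries
   have been put. *)
Definition cursor_at (n p t : nat) : cursor := iter t (next n p) start.

Definition at_last_entry (n p : nat) (c : cursor) : bool :=
  (row c == n * p) && (col c == n * p).

Definition in_matrix (n p : nat) (c : cursor) : bool :=
  (0 < row c <= n * p) && (0 < col c <= n * p).

(* The procedure stops after exactly m moves and never leaves the matrix. *)
Definition procedure_stops (n p m : nat) : Prop :=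
  [/\ at_last_entry n p (cursor_at n p m),
      forall t, t < m -> ~~ at_last_entry n p (cursor_at n p t) &
      forall t, t <= m -> in_matrix n p (cursor_at n p t)].

(* The k-th pass ends on the k * p-th entry put, in column k * p. *)
Definition pass_ends (n p m k : nat) : Prop :=
  exists t, [/\ t <= m, t.+1 = k * p &
    [/\ pass (cursor_at n p t) = k,
        rows_below n p (cursor_at n p t) = n - k &
        col (cursor_at n p t) = k * p]].

(* The ordinals i and j count from 0, hence the successors. *)
Definition procedure_matrix (K : pzRingType) (n p m : nat) : 'M[K]_(n * p) :=
  (\matrix_(i, j)
    if [exists t : 'I_m.+1, (row (cursor_at n p t) == i.+1)
                         && (col (cursor_at n p t) == j.+1)]
    then 1 else 0)%R.

(* Main.v *)
Require Import Defs.
From mathcomp Require Import all_boot all_order all_algebra.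
From mathcomp Require Import reals.
From mathcomp.real_closed Require Import complex mxtens.
From mathcomp Require Import zify.

(** Count rows and columns from 0.  Column k * p + r, with k < n and r < p,
    is the one that meets the tensor e_k (x) e_r of the basis, and row
    r * n + k carries its mirror image e_r (x) e_k.  Evaluated on the tensors
    e_k (x) e_r, the commutation property determines all the columns of the
    matrix: the entry at row r * n + k of column k * p + r is 1 and every
    other entry is 0 ([tensor_commutationE]); by bilinearity this matrix
    does commute all tensors.

    The procedure visits exactly these positions.  Its t-th move reaches
    column t; writing t = k * p + r, it is then at row r * n + k, because within
    a run r grows by 1 and the row by n, and the run that starts at row k stops
    when n - k - 1 rows remain, which is after p entries ([cursor_at_run]).
    The last position, k = n - 1 and r = p - 1, is the bottom right corner,
    reached after n * p - 1 moves.  *)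

Set Implicit Arguments.
Unset Strict Implicit.
Unset Printing Implicit Defensive.

Import GRing.Theory.
Local Open Scope ring_scope.

(** * The tensor commutation matrix *)

(** The row index of the tensor e_r (x) e_k, in the height n * p. *)
Definition swapped_row (n p : nat) (r : 'I_p) (k : 'I_n) : 'I_(n * p) :=
  cast_ord (mulnC p n) (mxtens_index (r, k)).

Variant swapped_row_spec (n p : nat) : 'I_(n * p) -> Type :=
  SwappedRow (r : 'I_p) (k : 'I_n) : swapped_row_spec (swapped_row r k).

(** Every row is of this form, so a matrix of height n * p is known from its
    rows of index [swapped_row r k]. *)
Lemma swapped_rowP (n p : nat) (i : 'I_(n * p)) : swapped_row_spec i.
Proof.
have ->: i = cast_ord (mulnC p n) (cast_ord (mulnC n p) i) by apply: val_inj.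
by case: (mxtens_indexP (cast_ord (mulnC n p) i)) => r k.
Qed.

Lemma tens_colE (K : pzRingType) (n p : nat) (a : 'cV[K]_n) (b : 'cV[K]_p)
    (k : 'I_n) (r : 'I_p) (z : 'I_(1 * 1)) :
  (a *t b) (mxtens_index (k, r)) z = a k 0 * b r 0.
Proof. by case: (mxtens_indexP z) => z1 z2; rewrite tensmxE !ord1. Qed.

Lemma swapped_tens_colE (K : pzRingType) (n p : nat)
    (a : 'cV[K]_n) (b : 'cV[K]_p) (r : 'I_p) (k : 'I_n) (z : 'I_(1 * 1)) :
  castmx (mulnC p n, erefl) (b *t a) (swapped_row r k) z = b r 0 * a k 0.
Proof. by rewrite castmxE /= cast_ordK cast_ord_id tens_colE. Qed.

Lemma tens_delta_col (K : pzRingType) (n p : nat) (k : 'I_n) (r : 'I_p) :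
  (delta_mx k 0 : 'cV[K]_n) *t (delta_mx r 0 : 'cV[K]_p)
  = delta_mx (mxtens_index (k, r)) 0.
Proof.
apply/matrixP => i z; case: (mxtens_indexP i) => k' r'.
rewrite tens_colE !mxE !andbT (can_eq (@mxtens_indexK n p)) xpair_eqE.
by rewrite (ord1 z) eqxx andbT -natrM mulnb.
Qed.

(** The product with e_k (x) e_r is the column k * p + r of U, and the
    commutation property says that this column is e_r (x) e_k.  Conversely,
    in a row of this 0-1 matrix the sum that computes the product has a single
    nonzero term, and a k * b r = b r * a k. *)
Lemma tensor_commutationE (K : comPzRingType) (n p : nat) (U : 'M[K]_(n * p)) :
  is_tensor_commutation U <->
  forall (r r' : 'I_p) (k k' : 'I_n),
    U (swapped_row r k) (mxtens_index (k', r')) = ((r == r') && (k == k'))%:R.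
Proof.
split=> [[_ commU] r r' k k' | entryU].
  have := commU (delta_mx k' 0) (delta_mx r' 0).
  move=> /matrixP /(_ (swapped_row r k) 0).
  rewrite swapped_tens_colE tens_delta_col -colE !mxE => ->.
  by rewrite !andbT -natrM mulnb.
split=> [i j | a b].
  case: (swapped_rowP i) => r k; case: (mxtens_indexP j) => k' r'.
  by rewrite entryU; case: (_ && _); [right | left].
apply/matrixP => i z; case: (swapped_rowP i) => r k.
rewrite swapped_tens_colE mxE (bigD1 (mxtens_index (k, r))) //= big1 => [|j].
  by rewrite addr0 entryU !eqxx mul1r tens_colE mulrC.
case: (mxtens_indexP j) => k' r'.
rewrite (can_eq (@mxtens_indexK n p)) xpair_eqE entryU andbC.
by rewrite (eq_sym r') (eq_sym k') => /negbTE ->; rewrite mul0r.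
Qed.

(** * The positions visited by the procedure *)

Local Open Scope nat_scope.

(** The run that starts at row k + 1 goes on while r < p - 1 because there
    n * p - (r * n + k + 1) exceeds n - (k + 1) by n * (p - 1 - r); this excess
    vanishes at r = p - 1, where the run that starts at row k + 2 begins. *)
Lemma cursor_at_run (n p k r : nat) : k < n -> r < p ->
  cursor_at n p (k * p + r) = Cursor k.+1 (r * n + k).+1 (k * p + r).+1.
Proof.
have nextE k1 r1 c : k1 < n -> r1 < p ->
    Defs.next n p (Cursor k1.+1 (r1 * n + k1).+1 c) =
    if r1.+1 == p then Cursor k1.+2 k1.+2 c.+1
    else Cursor k1.+1 (r1.+1 * n + k1).+1 c.+1.
  move=> k1n r1p; rewrite /Defs.next /rows_below /=.
  have le_np : r1.+1 * n <= n * p by rewrite mulnC leq_mul2l r1p orbT.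
  have -> : (n * p - (r1 * n + k1).+1 == n - k1.+1) = (r1.+1 == p).
    have -> : (r1.+1 == p) = (r1.+1 * n == n * p).
      by rewrite mulnC eqn_mul2l; case: (n) k1n.
    by apply/eqP/eqP; nia.
  by case: eqP => // _; congr Cursor; rewrite mulSn; lia.
have runE k1 : k1 < n -> cursor_at n p (k1 * p) = Cursor k1.+1 k1.+1 (k1 * p).+1 ->
    forall r1, r1 < p ->
    cursor_at n p (k1 * p + r1) = Cursor k1.+1 (r1 * n + k1).+1 (k1 * p + r1).+1.
  move=> k1n start_run; elim=> [|r1 IHr] r1p; first by rewrite addn0.
  rewrite addnS /cursor_at iterS -/(cursor_at n p _) (IHr (ltnW r1p)).
  by rewrite nextE ?(ltnW r1p) // ltn_eqF.
move=> kn rp; apply: (runE k) => //.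
elim: k kn => [//|k IHk] kn.
(* column (k + 1) * p follows the last column k * p + (p - 1) of run k *)
have p_gt0 : 0 < p by apply: leq_ltn_trans rp.
have -> : k.+1 * p = (k * p + p.-1).+1 by nia.
rewrite /cursor_at iterS -/(cursor_at n p _) (runE _ _ (IHk _)) ?prednK ?(ltnW kn) //.
by rewrite nextE ?prednK ?eqxx ?(ltnW kn).
Qed.

Lemma cursor_atE (n p t : nat) : t < n * p ->
  cursor_at n p t = Cursor (t %/ p).+1 (t %% p * n + t %/ p).+1 t.+1.
Proof.
move=> tnp; have p_gt0 : 0 < p by case: p tnp; rewrite ?muln0.
by rewrite {1}(divn_eq t p) cursor_at_run ?ltn_mod ?ltn_divLR // -divn_eq.
Qed.

Lemma procedure_stops_last (n p : nat) : 0 < n -> 0 < p ->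
  procedure_stops n p (n * p).-1.
Proof.
move=> n_gt0 p_gt0; have np_gt0 : 0 < n * p by rewrite muln_gt0 n_gt0.
split=> [|t|t].
- have -> : (n * p).-1 = n.-1 * p + p.-1 by nia.
  rewrite cursor_at_run ?prednK // /at_last_entry /=.
  by apply/andP; split; apply/eqP; nia.
- move=> t_lt; rewrite cursor_atE; last by lia.
  by rewrite /at_last_entry /= negb_and; apply/orP; right; apply/eqP; lia.
- move=> t_le; have tnp : t < n * p by lia.
  rewrite cursor_atE // /in_matrix /= tnp andbT.
  (* the row is the index of a tensor e_r (x) e_k *)
  have r_lt : t %% p < p by rewrite ltn_mod.
  have k_lt : t %/ p < n by rewrite ltn_divLR.
  by nia.
Qed.

Lemma pass_ends_last (n p k : nat) : 0 < p -> 0 < k <= n ->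
  pass_ends n p (n * p).-1 k.
Proof.
case: k => // k p_gt0 /= kn.
exists (k * p + p.-1).
have lastE : (k * p + p.-1).+1 = k.+1 * p by nia.
rewrite cursor_at_run ?prednK // /rows_below /= lastE.
by split=> //; [nia | split=> //; nia].
Qed.

(** In column k' * p + r' the procedure puts a single 1, at row r' * n + k'. *)
Lemma procedure_matrixE (K : comPzRingType) (n p : nat)
    (r r' : 'I_p) (k k' : 'I_n) :
  procedure_matrix K n p (n * p).-1 (swapped_row r k) (mxtens_index (k', r'))
  = ((r == r') && (k == k'))%:R%R.
Proof.
rewrite mxE.
have np_gt0 : 0 < n * p by apply: leq_ltn_trans (ltn_ord (swapped_row r k)).
have -> : (r == r') && (k == k') =
    (swapped_row r k == swapped_row r' k').
  by rewrite (inj_eq (@cast_ord_inj _ _ _)) (can_eq (@mxtens_indexK p n)).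
case: existsP => [[t /andP[/eqP rowt /eqP colt]] | no_t].
  have tnp : t < n * p by move: (ltn_ord t); lia.
  move: colt; rewrite cursor_atE // => -[colt].
  move: rowt; rewrite colt cursor_at_run // => -[rowt].
  by rewrite (_ : (_ == _) = true) //; apply/eqP/val_inj.
case: eqP => // eq_row; case: no_t.
have col_lt : mxtens_index (k', r') < (n * p).-1.+1 by rewrite prednK.
exists (Ordinal col_lt); rewrite cursor_at_run //= eqxx andbT eqSS.
by apply/eqP; move/(congr1 val): eq_row.
Qed.

Lemma tensor_commutation_procedure (K : comPzRingType) (n p : nat)
    (U : 'M[K]_(n * p)) :
  is_tensor_commutation U <-> U = procedure_matrix K n p (n * p).-1.
Proof.
rewrite tensor_commutationE; split=> [entryU | -> r r' k k'].
  apply/matrixP => i j; case: (swapped_rowP i) => r k.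
  by case: (mxtens_indexP j) => k' r'; rewrite entryU procedure_matrixE.
exact: procedure_matrixE.
Qed.

Theorem mainTheorem5 (R : realType) (n p : nat) (hn : 0 < n) (hp : 0 < p) :
  exists m : nat,
    [/\ procedure_stops n p m,
        forall k : nat, 0 < k <= n -> pass_ends n p m k,
        forall U : 'M[R]_(n * p),
          is_tensor_commutation U <-> U = procedure_matrix R n p m &
        forall U : 'M[R[i]]_(n * p),
          is_tensor_commutation U <-> U = procedure_matrix R[i] n p m].
Proof.
exists (n * p).-1; split.
- exact: procedure_stops_last.
- by move=> k; apply: pass_ends_last.
- by move=> U; apply: tensor_commutation_procedure.
- by move=> U; apply: tensor_commutation_procedure.
Qed.
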